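(* Let $k\ge 4$ be even and let $G=(V,E)$ be a $k$-uniform connected hypergraph with maximum degree $d>0$. Let $\mathcal L$ be the Laplacian tensor of $G$. Then $\lambda(\mathcal L)$ is equal to the unique real root of the equation $(1-\lambda)^{k-1}(\lambda-d)+d=0$ in the interval $(d,d+1)$ if and only if $G$ is a hyperstar.
   Context: Hypergraphs are undirected, simple, $k$-uniform (every edge has exactly $k$ vertices), with vertex set $V=[n]=\{1,\dots,n\}$, $n\ge k$, and nonempty edge set $E$. The degree $d_i$ of vertex $i$ is the number of edges containing $i$. Two different vertices $i,j$ are connected if there are edges $e_1,\dots,e_m$ with $i\in e_1$, $j\in e_m$ and $e_r\cap e_{r+1}\ne\emptyset$ for all $r\in[m-1]$; $G$ is connected if every pair of different vertices is connected. The adjacency tensor $\mathcal A$ is the $k$-th order $n$-dimensional tensor with $a_{i_1\dots i_k}=\frac1{(k-1)!}$ if $\{i_1,\dots,i_k\}\in E$ and $0$ otherwise; $\mathcal D$ is the diagonal tensor with diagonal entries $d_{i\dots i}=d_i$; the Laplacian tensor is $\mathcal L=\mathcal D-\mathcal A$. Thus $(\mathcal L\mathbf x^{k-1})_i=d_ix_i^{k-1}-\sum_{e\in E,\,i\in e}\prod_{j\in e\setminus\{i\}}x_j$. A real number $\lambda$ is an H-eigenvalue of $\mathcal L$ with H-eigenvector $\mathbf x\in\mathbb R^n\setminus\{0\}$ if $(\mathcal L\mathbf x^{k-1})_i=\lambda x_i^{k-1}$ for all $i\in[n]$. $\lambda(\mathcal L)$ denotes the largest H-eigenvalue of $\mathcal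 L$ (it exists). A $k$-uniform hypergraph $G=(V,E)$ is a hyperstar (of size $t\ge 1$) if there is a disjoint partition $V=V_0\cup V_1\cup\dots\cup V_t$ with $|V_0|=1$, $|V_1|=\dots=|V_t|=k-1$ and $E=\{V_0\cup V_i : i\in[t]\}$.
   Formalization: For d = 1 (a single edge) the equation has no root in (d,d+1), its roots being 0 and 2; the formal theorem states the claim with (d,d+1) for d > 1, and with the half-open interval (d,d+1] for every d > 0. *)

(* Defs.v *)
From mathcomp Require Import all_boot all_order all_algebra.
From mathcomp Require Export reals.

Set Implicit Arguments.
Unset Strict Implicit.
Unset Printing Implicit Defensive.

Import Order.TTheory GRing.Theory Num.Theory.
Local Open Scope ring_scope.

(* A hypergraph on the vertex set 'I_n is given by its edge set E. *)
Section Hypergraph.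
Variables (n : nat) (E : {set {set 'I_n}}).

Definition uniform_hypergraph (k : nat) : Prop :=
  [/\ (k <= n)%N, E != set0 & forall e : {set 'I_n}, e \in E -> #|e| = k].

Definition degree (i : 'I_n) : nat := #|[set e in E | i \in e]|.

Definition max_degree : nat := (\max_(i < n) degree i)%N.

(* The walk e_1, ..., e_m is the nonempty sequence e :: s. *)
Definition vertices_connected (i j : 'I_n) : Prop :=
  exists (e : {set 'I_n}) (s : seq {set 'I_n}),
    [/\ all [in E] (e :: s),
        i \in e,
        j \in last e s
      & path (fun a b : {set 'I_n} => a :&: b != set0) e s].

Definition connected_hypergraph : Prop :=
  forall i j : 'I_n, i != j -> vertices_connected i j.

Definition hyperstar (k : nat) : Prop :=
  exists (t : nat) (V : 'I_t.+1 -> {set 'I_n}),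
    [/\ (1 <= t)%N,
        (forall a b : 'I_t.+1, a != b -> [disjoint V a & V b])
          /\ \bigcup_(a < t.+1) V a = [set: 'I_n],
        #|V ord0| = 1%N,
        forall a : 'I_t, #|V (lift ord0 a)| = k.-1
      & E = [set V ord0 :|: V (lift ord0 a) | a : 'I_t]].

End Hypergraph.

Section Tensor.
Variables (R : realType) (k n : nat).

Definition tensor := k.-tuple 'I_n -> R.

(* (T x^{k-1})_i, the sum of t_{j_1 ... j_k} x_{j_2} ... x_{j_k} over the
   index tuples with j_1 = i. *)
Definition tensor_apply (T : tensor) (x : 'rV[R]_n) (i : 'I_n) : R :=
  \sum_(j : k.-tuple 'I_n | ohead j == Some i)
    T j * \prod_(l <- behead j) x ord0 l.

Definition H_eigenvalue (T : tensor) (lambda : R) : Prop :=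
  exists x : 'rV[R]_n,
    x != 0 /\
    forall i : 'I_n, tensor_apply T x i = lambda * x ord0 i ^+ k.-1.

Definition largest_H_eigenvalue (T : tensor) (lambda : R) : Prop :=
  H_eigenvalue T lambda /\ forall mu : R, H_eigenvalue T mu -> mu <= lambda.

Variable E : {set {set 'I_n}}.

(* If the edges have k elements, [set i in j] \in E forces the k indices of j
   to be pairwise distinct. *)
Definition adjacency_tensor : tensor := fun j =>
  if [set i in j] \in E then (k.-1)`!%:R^-1 else 0.

Definition degree_tensor : tensor := fun j =>
  if tval j is i :: s then
    if all (pred1 i) s then (degree E i)%:R else 0
  else 0.

Definition laplacian_tensor : tensor := fun j =>
  degree_tensor j - adjacency_tensor j.

End Tensor.

Arguments laplacian_tensor R k {n} E _.

Definition unique_root_in (R : realType) (k d : nat) (I : interval R) (r : R)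
    : Prop :=
  unique (fun x : R =>
    x \in I /\ (1 - x) ^+ k.-1 * (x - d%:R) + d%:R = 0) r.

Definition root_criterion (R : realType) (n k d : nat) (E : {set {set 'I_n}})
    (I : interval R) : Prop :=
  exists r : R,
    unique_root_in k d I r /\
    (largest_H_eigenvalue (laplacian_tensor R k E) r <-> hyperstar E k).

(* Main.v *)
(* Write Q(x) = L x^k.  For k even, a maximizer of Q on the compact set
   sum_i x_i^k = 1 is an H-eigenvector, so the largest H-eigenvalue r satisfies
   Q(x) <= r sum_i x_i^k for all x.  Apply this to x equal to 1 - r at a vertex s
   of maximum degree, to signs on the neighbours of s whose product over each
   e \ {s} is 1, and to 0 elsewhere.  When r is the root of the equation, the
   inequality forces the edges through s to meet only in s and every other edge
   to contribute 0; flipping two signs shows that no other edge meets a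
   neighbour of s, so by connectivity G is a hyperstar.  Conversely, on a
   hyperstar the eigenvalue equations at the centre and at a leaf of largest
   absolute value give (mu - 1)^(k-1) (mu - d) <= d for every H-eigenvalue
   mu > r, which contradicts monotonicity. *)

Require Import Defs.
From mathcomp Require Import classical_sets topology normedtype derive realfun.
From mathcomp Require Import all_boot all_order all_algebra.
From mathcomp Require Import reals.
From mathcomp Require Import ring lra.

Import Order.TTheory GRing.Theory Num.Theory.
Import numFieldNormedType.Exports.
Local Open Scope ring_scope.

(** * Coordinates of the Laplacian tensor applied to a vector *)

Lemma sum_tuple_ohead {V : nmodType} {T : finType} (k : nat) (i : T)
    (F : seq T -> V) :
  \sum_(j : k.+1.-tuple T | ohead j == Some i) F j
  = \sum_(t : k.-tuple T) F (i :: t).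
Proof.
rewrite (reindex_onto (fun t : k.-tuple T => [tuple of i :: t])
  (fun j => [tuple of behead j])) /=; last first.
  move=> j; case/tupleP: j => a t /= /eqP[->].
  by apply: val_inj.
apply: eq_bigl => t; rewrite eqxx /=.
by apply/eqP; apply: val_inj.
Qed.

(** By counting, [k.+1] indices can exhaust a set of [k.+1] elements only if they are distinct; the
    tuples [t] are thus the orderings of [e :\ i]. *)
Lemma set_cons_eq {T : finType} (k : nat) (i : T) (t : k.-tuple T)
    (e : {set T}) : #|e| = k.+1 -> i \in e ->
  ([set j in i :: t] == e) = all [in e :\ i] t && uniq t.
Proof.
move=> ce ie; have ci : #|e :\ i| = k.
  by move: (cardsD1 i e); rewrite ie ce => -[].
apply/eqP/andP => [eE | [/allP te ut]].
  have u : uniq (i :: t).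
    apply/card_uniqP; rewrite /= size_tuple -ce -eE cardsE.
    by apply: eq_card.
  case/andP: u => it ut; split=> //; apply/allP => j jt.
  rewrite !inE -eE !inE jt orbT andbT.
  by apply: contraNneq it => <-.
have tE : [set j in t] = e :\ i.
  apply/eqP; rewrite eqEcard; apply/andP; split.
    by apply/subsetP => j; rewrite inE => /te.
  by rewrite ci cardsE (card_uniqP ut) size_tuple.
apply/setP => j; rewrite !inE; have [->|ji] := eqVneq j i; first by rewrite ie.
by move/setP/(_ j): tE; rewrite !inE ji.
Qed.

Section LaplacianApply.
Variables (R : realType) (k n : nat) (E : {set {set 'I_n}}).
Hypothesis cardE : forall e : {set 'I_n}, e \in E -> #|e| = k.+1.

Lemma sum_set_cons (x : 'rV[R]_n) (i : 'I_n) (e : {set 'I_n}) :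
  e \in E -> i \in e ->
  \sum_(t : k.-tuple 'I_n | [set j in i :: t] == e)
    k`!%:R^-1 * \prod_(l <- t) x ord0 l = \prod_(j in e :\ i) x ord0 j.
Proof.
move=> eE ie; have ce := cardE _ eE.
have ci : #|e :\ i| = k by move: (cardsD1 i e); rewrite ie ce => -[].
rewrite (eq_bigl [in [set t : k.-tuple 'I_n | all [in e :\ i] t & uniq t]]);
  last first.
  by move=> t; rewrite inE set_cons_eq.
rewrite (eq_bigr (fun=> k`!%:R^-1 * \prod_(j in e :\ i) x ord0 j)); last first.
  move=> t; rewrite inE => /andP[te ut]; congr (_ * _).
  rewrite big_uniq //; apply: eq_bigl => j.
  have := set_cons_eq _ i t e ce ie; rewrite te ut => /eqP/setP/(_ j).
  rewrite !inE; have [->|ji] /= := eqVneq j i; last by [].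
  move=> _; apply/negbTE/negP => it.
  by move/allP/(_ _ it): te; rewrite !inE eqxx.
(* There are [k]! orderings of [e :\ i], which cancels the normalisation of the adjacency tensor. *)
rewrite sumr_const card_uniq_tuples.
rewrite (eq_card (B := e :\ i)) // ci ffactnn.
rewrite -[LHS]mulr_natl mulrA mulfV ?mul1r //.
by rewrite pnatr_eq0 -lt0n fact_gt0.
Qed.

Lemma tensor_apply_laplacian (x : 'rV[R]_n) (i : 'I_n) :
  tensor_apply (laplacian_tensor R k.+1 E) x i
  = (degree E i)%:R * x ord0 i ^+ k
    - \sum_(e in E | i \in e) \prod_(j in e :\ i) x ord0 j.
Proof.
rewrite /tensor_apply.
(* The summand as a function of a bare sequence, the shape that [sum_tuple_ohead] expects. *)
pose F (s : seq 'I_n) : R :=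
  ((if all (pred1 i) (behead s) then (degree E i)%:R else 0)
   - (if [set i in s] \in E then (k`!)%:R^-1 else 0))
  * \prod_(l <- behead s) x ord0 l.
rewrite (eq_bigr (fun j : k.+1.-tuple 'I_n => F j)); last first.
  move=> j; case/tupleP: j => a t /= /eqP[->].
  by rewrite /laplacian_tensor /degree_tensor /adjacency_tensor /F.
rewrite sum_tuple_ohead /F /=.
under eq_bigr do rewrite mulrBl.
rewrite big_split sumrN /=; congr (_ - _).
  (* In the diagonal part only the constant tuple survives. *)
  rewrite (bigD1 (nseq_tuple k i)) //= [X in _ + X = _]big1 ?addr0.
    by rewrite all_pred1_nseq big_nseq iter_mulr_1.
  move=> t tn; case: ifP; rewrite ?mul0r // => /all_pred1P.
  rewrite size_tuple => tE; case/eqP: tn; exact: val_inj.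
rewrite (eq_bigr (fun t : k.-tuple 'I_n => if [set j in i :: t] \in E then
    k`!%:R^-1 * \prod_(l <- t) x ord0 l else 0)); last first.
  by move=> t _; case: ifP; rewrite ?mul0r.
(* In the adjacency part the tuples are grouped by the edge that they span. *)
rewrite -big_mkcond (partition_big (fun t : k.-tuple 'I_n => [set j in i :: t])
   [pred e : {set 'I_n} | (e \in E) && (i \in e)]) /=; last first.
  by move=> t ->; rewrite !inE eqxx.
apply: eq_bigr => e /andP[eE ie]; rewrite -(sum_set_cons x i e) //.
by apply: eq_bigl => t; case: eqP => [->|]; rewrite ?eE ?andbF.
Qed.

End LaplacianApply.

(** * Variational bound for the largest H-eigenvalue *)

Lemma nth_root_exists (R : rcfType) (k : nat) (a : R) :
  0 <= a -> exists2 c : R, 0 <= c & c ^+ k.+1 = a.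
Proof.
move=> a0; have le0 : 0 <= 1 + a by rewrite addr_ge0.
have [|c /andP[c0 _]] := @poly_ivt R ('X ^+ k.+1 - a%:P) 0 (1 + a) le0.
  rewrite !hornerE expr0n /= sub0r oppr_le0 a0 subr_ge0.
  by apply: le_trans (ler_eXnr _ _); rewrite ?lerDr ?lerDl.
by rewrite /root !hornerE subr_eq0 => /eqP; exists c.
Qed.

(** Fermat's criterion, phrased with the formal derivative so that its later use is pure algebra. *)
Lemma deriv_at_min_horner {R : realType} (p : {poly R}) :
  (forall t, p.[0] <= p.[t]) -> p^`().[0] = 0.
Proof.
move=> pmin.
have H : is_derive (0 : R) 1 (horner p) 0.
  apply: (@derive1_at_min R (horner p) (-1) 1 0) => [|t _||t _].
  - by lra.
  - exact: derivable_horner.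
  - by rewrite in_itv /= ltrN10 ltr01.
  - exact: pmin.
by rewrite derive.derivE derive1E; case: H.
Qed.

Definition power_sum {R : realType} (k : nat) {n : nat} (x : 'rV[R]_n) : R :=
  \sum_i x ord0 i ^+ k.

(** This is the sum of x_i (L x^{k-1})_i over all i, regrouped by edges: each edge of size [k]
    yields its product once for each of its vertices. *)
Definition laplacian_form {R : realType} (k : nat) {n : nat}
    (E : {set {set 'I_n}}) (x : 'rV[R]_n) : R :=
  \sum_(e in E) (\sum_(i in e) x ord0 i ^+ k - k%:R * \prod_(i in e) x ord0 i).

Section Variational.
Variables (R : realType) (k n : nat) (E : {set {set 'I_n}}).
Hypothesis cardE : forall e : {set 'I_n}, e \in E -> #|e| = k.+1.
Hypothesis odd_k : odd k.

Implicit Types (x y : 'rV[R]_n) (t c : R) (i : 'I_n).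

Let shift x i t := x + t *: delta_mx ord0 i.

Let shiftE x i t j : shift x i t ord0 j = x ord0 j + t * (j == i)%:R.
Proof. by rewrite !mxE eqxx. Qed.

Lemma sum_shift x i t (A : {set 'I_n}) :
  \sum_(j in A) shift x i t ord0 j ^+ k.+1
  = \sum_(j in A) x ord0 j ^+ k.+1
    + (i \in A)%:R * ((x ord0 i + t) ^+ k.+1 - x ord0 i ^+ k.+1).
Proof.
have [iA|iA] := boolP (i \in A); last first.
  rewrite mul0r addr0; apply: eq_bigr => j jA; rewrite shiftE.
  have /negbTE-> : j != i by apply: contraNneq iA => <-.
  by rewrite mulr0 addr0.
rewrite (bigD1 i) //= [in RHS](bigD1 i) //= shiftE eqxx mulr1 mul1r.
rewrite (eq_bigr (fun j => x ord0 j ^+ k.+1)); last first.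
  by move=> j /andP[_ /negbTE ji]; rewrite shiftE ji mulr0 addr0.
by ring.
Qed.

Lemma prod_shift x i t (A : {set 'I_n}) :
  \prod_(j in A) shift x i t ord0 j
  = \prod_(j in A) x ord0 j
    + (i \in A)%:R * (t * \prod_(j in A :\ i) x ord0 j).
Proof.
have [iA|iA] := boolP (i \in A); last first.
  rewrite mul0r addr0; apply: eq_bigr => j jA; rewrite shiftE.
  have /negbTE-> : j != i by apply: contraNneq iA => <-.
  by rewrite mulr0 addr0.
rewrite (big_setD1 i) //= [in RHS](big_setD1 i) //=.
rewrite shiftE eqxx mulr1 mul1r mulrDl.
rewrite (eq_bigr (fun j => x ord0 j)) // => j; rewrite !inE shiftE.
by move=> /andP[/negbTE-> _]; rewrite mulr0 addr0.
Qed.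

Lemma power_sum_shift x i t :
  power_sum k.+1 (shift x i t)
  = power_sum k.+1 x + ((x ord0 i + t) ^+ k.+1 - x ord0 i ^+ k.+1).
Proof.
have := sum_shift x i t [set: 'I_n]; rewrite inE mul1r /power_sum.
by under eq_bigl do rewrite inE; under [X in _ = X + _]eq_bigl do rewrite inE.
Qed.

(** Each edge product is affine in a single coordinate, so [t] enters the last term only
    linearly. *)
Lemma laplacian_form_shift x i t :
  laplacian_form k.+1 E (shift x i t)
  = laplacian_form k.+1 E x
    + (degree E i)%:R * ((x ord0 i + t) ^+ k.+1 - x ord0 i ^+ k.+1)
    - k.+1%:R * t * \sum_(e in E | i \in e) \prod_(j in e :\ i) x ord0 j.
Proof.
rewrite /laplacian_form.
set D := _ - x ord0 i ^+ _.
rewrite (eq_bigr (fun e : {set 'I_n} => (\sum_(j in e) x ord0 j ^+ k.+1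
    - k.+1%:R * \prod_(j in e) x ord0 j)
  + (if i \in e then D - k.+1%:R * t * \prod_(j in e :\ i) x ord0 j else 0))).
  rewrite big_split /= -addrA; congr (_ + _).
  rewrite -big_mkcondr big_split sumrN /= -mulr_sumr; congr (_ - _).
  rewrite sumr_const mulr_natl; congr (_ *+ _).
  by rewrite /degree; apply: eq_card => e; rewrite !inE.
move=> e _; rewrite sum_shift prod_shift -/D.
by case: (i \in e) => /=; rewrite ?mul1r ?mul0r; ring.
Qed.

Lemma laplacian_formZ c x :
  laplacian_form k.+1 E (c *: x) = c ^+ k.+1 * laplacian_form k.+1 E x.
Proof.
rewrite /laplacian_form mulr_sumr; apply: eq_bigr => e eE.
rewrite mulrBr mulr_sumr mulrCA; congr (_ - _ * _).
  by apply: eq_bigr => i _; rewrite mxE exprMn.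
under eq_bigr do rewrite mxE.
by rewrite big_split /= prodr_const cardE.
Qed.

Lemma power_sumZ c x : power_sum k.+1 (c *: x) = c ^+ k.+1 * power_sum k.+1 x.
Proof.
by rewrite /power_sum mulr_sumr; apply: eq_bigr => i _; rewrite mxE exprMn.
Qed.

Lemma even_pow_ge0 (a : R) : 0 <= a ^+ k.+1.
Proof. by rewrite exprn_even_ge0 //= odd_k. Qed.

Lemma power_sum_ge0 x : 0 <= power_sum k.+1 x.
Proof. by apply: sumr_ge0 => i _; exact: even_pow_ge0. Qed.

Lemma power_sum_eq0 x : (power_sum k.+1 x == 0) = (x == 0).
Proof.
apply/eqP/eqP => [|->]; last first.
  by rewrite /power_sum big1 // => i _; rewrite mxE expr0n.
move=> /eqP; rewrite psumr_eq0 => [/allP x0|i _]; last exact: even_pow_ge0.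
apply/rowP => i; have := x0 i (mem_index_enum i).
by rewrite mxE expf_eq0 => /andP[_ /eqP].
Qed.

Lemma continuous_coordX m i : continuous (fun x => x ord0 i ^+ m).
Proof.
move=> x.
apply: (@continuous_comp _ _ _ (fun x => x ord0 i) (fun a : R => a ^+ m)).
  exact: coord_continuous.
exact: exprn_continuous.
Qed.

Lemma continuous_power_sum : continuous (power_sum k.+1 : 'rV[R]_n -> R).
Proof.
apply: continuous_big => [|i _]; last exact: continuous_coordX.
exact: add_continuous.
Qed.

Lemma continuous_laplacian_form :
  continuous (laplacian_form k.+1 E : 'rV[R]_n -> R).
Proof.
have cP (e : {set 'I_n}) :
    continuous (fun x => \sum_(i in e) x ord0 i ^+ k.+1 : R).
  apply: continuous_big => [|i _]; last exact: continuous_coordX.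
  exact: add_continuous.
have cQ (e : {set 'I_n}) : continuous (fun x => \prod_(i in e) x ord0 i : R).
  apply: continuous_big => [|i _]; last exact: coord_continuous.
  exact: mul_continuous.
apply: continuous_big => [|e _]; first exact: add_continuous.
move=> x.
apply: (@continuousB _ _ _ (fun x => \sum_(i in e) x ord0 i ^+ k.+1 : R)).
  exact: cP.
apply: continuousM; [exact: cst_continuous|exact: cQ].
Qed.

Lemma compact_power_sphere :
  compact [set x : 'rV[R]_n | power_sum k.+1 x = 1]%classic.
Proof.
apply: bounded_closed_compact.
  exists 1; split => // M M1 x /= xS.
  apply: le_trans (ltW M1); rewrite [leLHS]mx_normrE.
  apply: bigmax_le => // -[a i] _ /=; rewrite ord1.
  rewrite -(@expr_le1 _ k.+1) // -normrX ger0_norm ?even_pow_ge0 // -xS.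
  rewrite /power_sum (bigD1 i) //= lerDl.
  by apply: sumr_ge0 => j _; exact: even_pow_ge0.
apply: (@closed_comp _ _ (power_sum k.+1) [set 1]%classic).
  by move=> x _; exact: continuous_power_sum.
exact: closed_eq.
Qed.

(** The maximum over the compact sphere extends to every [y] because both forms are homogeneous of
    degree [k.+1]. In this form the bound carries no constraint, so no Lagrange multiplier is
    needed. The index [i] provides a point of the sphere. *)
Lemma laplacian_form_max i :
  exists2 x, power_sum k.+1 x = 1 &
    forall y,
      laplacian_form k.+1 E y <= laplacian_form k.+1 E x * power_sum k.+1 y.
Proof.
have S0 : ([set x : 'rV[R]_n | power_sum k.+1 x = 1] !=set0)%classic.
  exists (delta_mx ord0 i); rewrite /= /power_sum (bigD1 i) //= big1.
    by rewrite !mxE !eqxx expr1n addr0.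
  by move=> j ji; rewrite mxE (negbTE ji) andbF expr0n.
have [x] := compact_EVT_max S0 compact_power_sphere
  (continuous_subspaceT continuous_laplacian_form).
move=> /set_mem xS xmax; exists x => // y.
have [->|y0] := eqVneq y 0.
  rewrite -(scale0r 0) laplacian_formZ power_sumZ expr0n /= !mul0r mulr0.
  exact: lexx.
have [c c0 cE] := nth_root_exists _ k _ (power_sum_ge0 y).
have Ny0 : power_sum k.+1 y != 0 by rewrite power_sum_eq0.
have cn0 : c != 0 by apply: contraNneq Ny0 => c00; rewrite -cE c00 expr0n.
have -> : y = c *: (c^-1 *: y) by rewrite scalerA divff // scale1r.
have yS : power_sum k.+1 (c^-1 *: y) = 1.
  by rewrite power_sumZ exprVn cE mulVf.
rewrite laplacian_formZ power_sumZ yS mulr1 mulrC ler_wpM2r ?even_pow_ge0 //.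
by apply: xmax; exact: mem_set.
Qed.

(* In each coordinate direction, lambda * power_sum - laplacian_form is a
   nonnegative polynomial vanishing at x; its zero derivative is the
   eigenvalue equation. *)
Lemma maximizer_eigen x (lambda : R) :
    (forall y, laplacian_form k.+1 E y <= lambda * power_sum k.+1 y) ->
    laplacian_form k.+1 E x = lambda * power_sum k.+1 x ->
  forall i,
    tensor_apply (laplacian_tensor R k.+1 E) x i = lambda * x ord0 i ^+ k.
Proof.
move=> le_lambda xmax i; rewrite tensor_apply_laplacian //.
set P := \sum_(e in E | _) _.
pose p : {poly R} :=
  (lambda - (degree E i)%:R) *: (('X + (x ord0 i)%:P) ^+ k.+1)
  - ((lambda - (degree E i)%:R) * x ord0 i ^+ k.+1)%:P
  + (k.+1%:R * P) *: 'X.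
have pE (t : R) : p.[t] = lambda * power_sum k.+1 (shift x i t)
    - laplacian_form k.+1 E (shift x i t).
  rewrite power_sum_shift laplacian_form_shift xmax -/P.
  rewrite /p !(hornerD, hornerN, hornerZ, horner_exp, hornerX, hornerC) (addrC t).
  by set A := (_ + t) ^+ _; ring.
have /deriv_at_min_horner : forall t, p.[0] <= p.[t].
  move=> t; rewrite !pE /shift scale0r addr0 xmax subrr subr_ge0.
  exact: le_lambda.
rewrite /p !derivCE !(hornerD, hornerMn, hornerN, hornerZ, hornerM).
rewrite !(horner_exp, hornerD, hornerX, hornerC).
rewrite addr0 mul1r add0r subr0 mulr1 /= -(mulr_natl (x ord0 i ^+ k)).
rewrite mulrCA -mulrDr => /eqP.
rewrite mulf_eq0 pnatr_eq0 /= => /eqP H.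
by apply/eqP; rewrite -subr_eq0 -oppr_eq0 -H; apply/eqP; ring.
Qed.

(** The maximum of the form on the sphere is itself an H-eigenvalue, hence at most [r]. *)
Lemma laplacian_form_le_largest r :
  largest_H_eigenvalue (laplacian_tensor R k.+1 E) r ->
  forall y, laplacian_form k.+1 E y <= r * power_sum k.+1 y.
Proof.
move=> [[z [z0 _]] rmax] y.
have [i _] : exists i, z ord0 i != 0 by exact/rV0Pn.
have [x x1 xmax] := laplacian_form_max i.
apply: le_trans (xmax y) _; rewrite ler_wpM2r ?power_sum_ge0 //; apply: rmax.
exists x; split; first by rewrite -power_sum_eq0 x1 oner_eq0.
by apply: maximizer_eigen => //; rewrite x1 mulr1.
Qed.

End Variational.

(** * Hyperstars described by their centre *)

Section Star.
Context {n : nat} (E : {set {set 'I_n}}).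

Definition star_centre (s : 'I_n) : Prop :=
  (forall e, e \in E -> s \in e) /\
  forall e f v, e \in E -> f \in E -> e != f -> v \in e -> v \in f -> v = s.

Lemma connected_cover (i j : 'I_n) :
  connected_hypergraph E -> i != j -> exists2 e, e \in E & i \in e.
Proof. by move=> cE /cE [e [p [/= /andP[eE _] ie _ _]]]; exists e. Qed.

Lemma hyperstar_centre (k : nat) :
  hyperstar E k -> exists s, star_centre s.
Proof.
case=> t [V [t1 [Vdis Vcov] /eqP/cards1P[s V0] _ EV]].
exists s; split=> [e|e f v]; rewrite EV.
  case/imsetP=> a _ ->.
  by rewrite V0 !inE eqxx.
move=> /imsetP[a _ ->] /imsetP[b _ ->].
have [->|ab _] := eqVneq a b; first by rewrite eqxx.
rewrite V0 !inE; case: eqVneq => //= _ va vb.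
have : lift ord0 a != lift ord0 b by rewrite (inj_eq lift_inj).
by move/Vdis/disjointFr/(_ va); rewrite vb.
Qed.

(** The leaf classes are the sets [e :\ s], numbered by the enumeration of [E]; connectivity makes
    them cover every vertex other than [s]. *)
Lemma centre_hyperstar (k : nat) (s : 'I_n) :
    uniform_hypergraph E k.+1 -> connected_hypergraph E ->
  star_centre s -> hyperstar E k.+1.
Proof.
move=> [_ E0 cardE] cE [sE Es].
pose V (a : 'I_#|E|.+1) : {set 'I_n} :=
  if unlift ord0 a is Some b then enum_val b :\ s else [set s].
have V0 : V ord0 = [set s] by rewrite /V unlift_none.
have VS b : V (lift ord0 b) = enum_val b :\ s by rewrite /V liftK.
have sV b : s |: V (lift ord0 b) = enum_val b.
  by rewrite VS setD1K // sE // enum_valP.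
exists #|E|, V; split.
- by rewrite lt0n cards_eq0.
- split=> [a b|].
    have [a' ->|->] := unliftP ord0 a; have [b' ->|->] := unliftP ord0 b;
      rewrite ?V0 ?VS ?eqxx // => ab.
    + rewrite -setI_eq0; apply/eqP/setP => v; rewrite !inE.
      have ab' : enum_val a' != enum_val b'.
        by rewrite (inj_eq enum_val_inj); apply: contraNneq ab => ->.
      have [//|/= vs] := eqVneq v s; apply/negP => /andP[va vb].
      by move/eqP: vs; apply; apply: Es ab' va vb; exact: enum_valP.
    + by rewrite disjoint_sym disjoints1 !inE eqxx.
    + by rewrite disjoints1 !inE eqxx.
  apply/setP => v; rewrite inE; apply/bigcupP.
  have [->|vs] := eqVneq v s; first by exists ord0; rewrite ?V0 ?inE.
  have [e eE ve] := connected_cover _ _ cE vs.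
  exists (lift ord0 (enum_rank_in eE e)) => //.
  by rewrite VS enum_rankK_in // !inE vs.
- by rewrite V0 cards1.
- move=> a; rewrite VS; have aE := enum_valP a.
  by move: (cardsD1 s (enum_val a)); rewrite sE // (cardE _ aE) => -[].
- apply/setP => e; apply/idP/imsetP => [eE|[a _ ->]].
    by exists (enum_rank_in eE e) => //; rewrite V0 sV enum_rankK_in.
  by rewrite V0 sV enum_valP.
Qed.

Lemma degree_centre (s : 'I_n) : star_centre s -> degree E s = max_degree E.
Proof.
move=> [sE _]; apply/eqP; rewrite eqn_leq leq_bigmax /=.
apply/bigmax_leqP => i _; apply: subset_leq_card; apply/subsetP => e.
by rewrite !inE => /andP[eE _]; rewrite eE sE.
Qed.

Lemma degree_leaf (s i : 'I_n) : connected_hypergraph E -> star_centre s ->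
  i != s -> degree E i = 1%N.
Proof.
move=> cE [_ Es] i_s; have [e eE ie] := connected_cover _ _ cE i_s.
apply/eqP/cards1P; exists e; apply/setP => f; rewrite !inE.
apply/andP/eqP => [[fE fi]|-> //].
by apply: contra_neq_eq i_s => fe; apply: Es fe fi ie.
Qed.

End Star.

(** * The polynomial equation and its root *)

Section Equation.
Variables (R : realType) (k d : nat).
Hypothesis odd_k : odd k.
Implicit Types x y : R.

(** As [k] is odd, the sign can be moved out of the power; the new left side is increasing from [d]
    on. *)
Lemma equation_pos x :
  ((1 - x) ^+ k * (x - d%:R) + d%:R = 0) <-> ((x - 1) ^+ k * (x - d%:R) = d%:R).
Proof.
rewrite -(opprB x 1) exprNn -signr_odd odd_k expr1 mulN1r mulNr addrC.
by split => [/eqP|->]; rewrite ?subrr // subr_eq0 => /eqP.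
Qed.

Lemma equation_lt x y : (0 < d)%N -> d%:R <= x -> x < y ->
  (x - 1) ^+ k * (x - d%:R) < (y - 1) ^+ k * (y - d%:R).
Proof.
move=> d0 dx xy; have d1 : 1 <= d%:R :> R by rewrite ler1n.
apply: (@le_lt_trans _ _ ((y - 1) ^+ k * (x - d%:R))).
  rewrite ler_wpM2r ?subr_ge0 // lerXn2r ?nnegrE ?subr_ge0 //; lra.
by rewrite ltr_pM2l ?ltrD2r // exprn_gt0 // subr_gt0; lra.
Qed.

(** Intermediate values: (x - 1)^k (x - d) - d equals -d at d and d^k - d at d + 1. The latter
    vanishes when d = 1, so the right endpoint is excluded only for d > 1. *)
Lemma equation_root : (1 < k)%N -> (0 < d)%N -> exists r : R,
  [/\ d%:R < r, r <= d%:R + 1, (1 < d)%N -> r < d%:R + 1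
    & (1 - r) ^+ k * (r - d%:R) + d%:R = 0].
Proof.
move=> k1 d0.
pose p : {poly R} := ('X - 1%:P) ^+ k * ('X - (d%:R)%:P) - (d%:R)%:P.
have pE x : p.[x] = (x - 1) ^+ k * (x - d%:R) - d%:R.
  by rewrite /p !(hornerD, hornerN, hornerM, horner_exp, hornerX, hornerC).
have p1 : p.[d%:R + 1] = d%:R ^+ k - d%:R.
  by rewrite pE addrK [_ + 1]addrC addrK mulr1.
have dgt0 : 0 < d%:R :> R by rewrite ltr0n.
have [||r /andP[dr r1] /eqP] := @poly_ivt R p d%:R (d%:R + 1).
- by rewrite lerDl.
- rewrite p1 pE subrr mulr0 sub0r oppr_le0 ler0n subr_ge0 /=.
  by apply: ler_eXnr; rewrite ?ler1n // ltnW.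
rewrite pE => /eqP; rewrite subr_eq0 => /eqP rE.
exists r; split => //; last exact/equation_pos.
  rewrite lt_neqAle dr andbT; apply/eqP => rd.
  by move: dgt0; rewrite -rE -rd subrr mulr0 ltxx.
move=> d1; rewrite lt_neqAle r1 andbT; apply/eqP => rd.
have : d%:R < d%:R ^+ k :> R by rewrite ltr_eXnr ?ltr1n.
by rewrite -subr_gt0 -p1 -rd pE rE subrr ltxx.
Qed.

End Equation.

(** * H-eigenvalues of a hyperstar *)

Section StarSpectrum.
Variables (R : realType) (k n : nat) (E : {set {set 'I_n}}) (s : 'I_n).
Hypothesis cardE : forall e : {set 'I_n}, e \in E -> #|e| = k.+1.
Hypothesis connE : connected_hypergraph E.
Hypothesis starE : star_centre E s.
Hypothesis k_gt0 : (0 < k)%N.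

Let d := max_degree E.
Hypothesis d_gt0 : (0 < d)%N.

Lemma sum_degree_const (i : 'I_n) (c : R) :
  \sum_(e in E | i \in e) c = (degree E i)%:R * c.
Proof.
rewrite sumr_const mulr_natl; congr (_ *+ _).
by rewrite /degree; apply: eq_card => e; rewrite !inE.
Qed.

Lemma card_edge_D1 (e : {set 'I_n}) (i : 'I_n) :
  e \in E -> i \in e -> #|e :\ i| = k.
Proof. by move=> eE ie; move: (cardsD1 i e); rewrite ie (cardE _ eE) => -[]. Qed.

(** With 1 - r at the centre and 1 elsewhere, the equation at a leaf reads 1 - (1 - r) = r and holds
    for any r; the equation at the centre is the hypothesis on r. *)
Lemma star_eigenvalue (r : R) : (1 - r) ^+ k * (r - d%:R) + d%:R = 0 ->
  H_eigenvalue (laplacian_tensor R k.+1 E) r.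
Proof.
move=> rE.
pose x : 'rV[R]_n := \row_i if i == s then 1 - r else 1.
have xs : x ord0 s = 1 - r by rewrite mxE eqxx.
have xl i : i != s -> x ord0 i = 1 by rewrite mxE => /negbTE->.
exists x; split.
  (* The vector is nonzero already at [s]: r = 1 would turn the equation into d = 0. *)
  apply/eqP => x0; have r1 : 1 - r = 0 by rewrite -xs x0 mxE.
  move/eqP: rE; rewrite r1 expr0n -(negbK (k == 0)%N) -lt0n k_gt0 mul0r add0r.
  by rewrite pnatr_eq0 -(negbK (d == 0)%N) -lt0n d_gt0.
move=> i; rewrite tensor_apply_laplacian //=.
have [->|i_s] := eqVneq i s.
  rewrite xs (eq_bigr (fun=> 1)) => [|e /andP[eE se]]; last first.
    by apply: big1 => j; rewrite !inE => /andP[/xl].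
  rewrite sum_degree_const degree_centre // -/d mulr1.
  by apply/eqP; rewrite -subr_eq0 -oppr_eq0; apply/eqP; rewrite -rE; ring.
rewrite xl // (eq_bigr (fun=> 1 - r)) => [|e /andP[eE ie]]; last first.
  have se : s \in e :\ i by rewrite !inE eq_sym i_s starE.1.
  rewrite (big_setD1 s) //= xs big1 ?mulr1 // => j.
  by rewrite !inE => /andP[/xl].
by rewrite sum_degree_const (degree_leaf _ s) // expr1n; ring.
Qed.

Lemma star_eigenvalue_le (r mu : R) : odd k ->
    d%:R < r -> (1 - r) ^+ k * (r - d%:R) + d%:R = 0 ->
  H_eigenvalue (laplacian_tensor R k.+1 E) mu -> mu <= r.
Proof.
move=> odd_k dr /(equation_pos _ _ _ odd_k) rE [x [x0 xE]].
rewrite leNgt; apply/negP => rmu.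
have d1 : 1 <= d%:R :> R by rewrite ler1n.
have mu1 : 0 < mu - 1 by lra.
have mud : 0 < mu - d%:R by lra.
(* It suffices to bound a leaf [m] of largest absolute value. Its only edge contains [s] and [k.-1]
   other leaves, each at most |x_m|; the common power of |x_m| is then cancelled, which needs x_m
   nonzero. *)
have leaf i : i != s -> (mu - 1) * `|x ord0 i| <= `|x ord0 s|.
  move=> i_s; have [m ms mmax] :=
    @arg_maxP _ R _ i (fun j => j != s) (fun j => `|x ord0 j|) i_s.
  apply: (@le_trans _ _ ((mu - 1) * `|x ord0 m|)).
    rewrite ler_pM2l //; exact: mmax.
  have [->|xm0] := eqVneq (x ord0 m) 0; first by rewrite normr0 mulr0.
  have [e eE me] := connected_cover _ _ _ connE ms.
  have se : s \in e :\ m by rewrite !inE eq_sym ms starE.1.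
  have : (mu - 1) * `|x ord0 m| ^+ k <= `|x ord0 s| * `|x ord0 m| ^+ k.-1.
    have -> : (mu - 1) * `|x ord0 m| ^+ k = `|\prod_(j in e :\ m) x ord0 j|.
      have := xE m; rewrite tensor_apply_laplacian // (degree_leaf _ s) //.
      rewrite (big_pred1 e) => [|f /=]; last first.
        apply/andP/eqP => [[fE mf]|-> //].
        by apply: contra_neq_eq ms => fe; apply: starE.2 fe mf me.
      move=> /(congr1 (fun z => x ord0 m ^+ k - z)).
      rewrite mul1r opprB addrCA subrr addr0 => ->.
      have -> : x ord0 m ^+ k - mu * x ord0 m ^+ k.+1.-1
        = (1 - mu) * x ord0 m ^+ k by rewrite mulrBl mul1r.
      by rewrite normrM normrX distrC (gtr0_norm mu1).
    rewrite normr_prod (big_setD1 s) //= ler_wpM2l //.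
    have -> : k.-1 = #|e :\ m :\ s|.
      by move: (cardsD1 s (e :\ m)); rewrite se (card_edge_D1 e m eE me) => ->.
    rewrite -prodr_const; apply: ler_prod => j; rewrite !inE => /and3P[js _ _].
    by rewrite normr_ge0; exact: mmax.
  rewrite -[in X in X <= _ -> _](prednK k_gt0) exprS mulrA ler_pM2r //.
  by rewrite exprn_gt0 // normr_gt0.
(* If x_s were 0, [leaf] would force the whole eigenvector to vanish. *)
have xs0 : 0 < `|x ord0 s|.
  rewrite normr_gt0; apply: contraNneq x0 => xs0; apply/eqP/rowP => i.
  have [->|/leaf] := eqVneq i s; first by rewrite xs0 mxE.
  rewrite xs0 normr0 mxE pmulr_rle0 // normr_le0 => /eqP; exact.
have := equation_lt _ k _ _ _ d_gt0 (ltW dr) rmu.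
rewrite rE ltNge => /negP; apply.
have xk0 : 0 < `|x ord0 s| ^+ k by rewrite exprn_gt0.
rewrite -(ler_pM2r xk0) -mulrA.
have -> : (mu - d%:R) * `|x ord0 s| ^+ k
    = `|\sum_(e in E | s \in e) \prod_(j in e :\ s) x ord0 j|.
  have := xE s; rewrite tensor_apply_laplacian // degree_centre // -/d.
  move=> /(congr1 (fun z => d%:R * x ord0 s ^+ k - z)).
  rewrite opprB addrCA subrr addr0 -mulrBl => ->.
  by rewrite normrM distrC normrX (gtr0_norm mud).
apply: (@le_trans _ _ ((mu - 1) ^+ k *
    \sum_(e in E | s \in e) \prod_(j in e :\ s) `|x ord0 j|)).
  rewrite ler_pM2l ?exprn_gt0 //; apply: le_trans (ler_norm_sum _ _ _) _.
  by apply: ler_sum => e _; rewrite normr_prod.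
(* Each of the [k] leaves of an edge absorbs one factor mu - 1 through [leaf], so every one of the d
   edges contributes at most |x_s|^k. *)
rewrite mulr_sumr /d -(degree_centre _ s starE) -sum_degree_const.
apply: ler_sum => e /andP[eE se].
rewrite -(card_edge_D1 e s eE se) -!prodr_const -big_split /=.
apply: ler_prod => j; rewrite !inE => /andP[js _].
by rewrite leaf // mulr_ge0 // ltW.
Qed.

End StarSpectrum.

(** * The converse: tightness of the bound forces a hyperstar *)

Lemma prod_sign_indicator {R : comPzRingType} {T : finType} (A B : {set T}) :
  \prod_(i in A) (-1) ^+ (i \in B) = (-1) ^+ #|A :&: B| :> R.
Proof.
rewrite -prodr_const (eq_bigr (fun i => if i \in B then -1 else 1)) => [|i _].
  by rewrite -big_mkcondr; apply: eq_bigl => i; rewrite !inE.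
by case: (i \in B).
Qed.

Section Converse.
Variables (R : realType) (k n : nat) (E : {set {set 'I_n}}) (s : 'I_n).
Hypothesis cardE : forall e : {set 'I_n}, e \in E -> #|e| = k.+1.
Hypothesis connE : connected_hypergraph E.
Hypothesis odd_k : odd k.
Hypothesis k_gt1 : (1 < k)%N.

Definition link : {set {set 'I_n}} :=
  [set e :\ s | e in [set e in E | s \in e]].

Definition neighbours : {set 'I_n} := cover link.

Lemma linkP (A : {set 'I_n}) :
  reflect (exists e, [/\ e \in E, s \in e & A = e :\ s]) (A \in link).
Proof.
apply: (iffP imsetP) => [[e]|[e [eE se ->]]]; last by exists e; rewrite ?inE ?eE.
by rewrite inE => /andP[eE se] ->; exists e.
Qed.

Lemma setD1_inj_in : {in [set e in E | s \in e] &, injective (fun e => e :\ s)}.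
Proof.
move=> e f; rewrite !inE => /andP[_ se] /andP[_ sf] ef.
by rewrite -(setD1K se) ef setD1K.
Qed.

Lemma card_link_set (A : {set 'I_n}) : A \in link -> #|A| = k.
Proof.
move=> /linkP[e [eE se ->]]; move: (cardsD1 s e).
by rewrite se (cardE _ eE) => -[].
Qed.

(** Union bound over the [degree E s] link sets of size [k]; equality means that the edges through
    [s] meet only in [s]. *)
Lemma card_neighbours :
  (#|neighbours| <= degree E s * k ?= iff trivIset link)%N.
Proof.
have -> : (degree E s * k = \sum_(A in link) #|A|)%N; last exact: leq_card_cover.
rewrite (eq_bigr (fun=> k)) => [|A]; last exact: card_link_set.
by rewrite sum_nat_const /link card_in_imset //; exact: setD1_inj_in.
Qed.

Lemma centre_notin_neighbours : s \notin neighbours.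
Proof. by apply/bigcupP => -[A /linkP[e [_ _ ->]]]; rewrite !inE eqxx. Qed.

Lemma edge_neighbours (e : {set 'I_n}) (v : 'I_n) :
  e \in E -> s \in e -> v \in e -> v != s -> v \in neighbours.
Proof.
move=> eE se ve vs; apply/bigcupP; exists (e :\ s); last by rewrite !inE vs.
by apply/linkP; exists e.
Qed.

Variable a : R.

(* For B = set0 and a = r - 1 this restricts to the eigenvector for r on a
   hyperstar centred at s; flipping the signs on a set B that is [balanced]
   leaves the contribution of the edges through s unchanged. *)
Definition test_vector (B : {set 'I_n}) : 'rV[R]_n :=
  \row_i if i == s then - a
         else if i \in neighbours then (-1) ^+ (i \in B) else 0.

(** The contribution to the form of an edge [f] missing [s]: even powers of signs count its
    neighbours of [s], and the product vanishes unless all its vertices are such neighbours. *)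
Definition excess (B f : {set 'I_n}) : R :=
  #|f :&: neighbours|%:R
  - k.+1%:R * (if f \subset neighbours then (-1) ^+ #|f :&: B| else 0).

Definition balanced (B : {set 'I_n}) : Prop :=
  forall A, A \in link -> ~~ odd #|A :&: B|.

Lemma test_vector_pow (B : {set 'I_n}) (i : 'I_n) : i != s ->
  test_vector B ord0 i ^+ k.+1 = (i \in neighbours)%:R.
Proof.
rewrite mxE => /negbTE->; case: ifP => _; last by rewrite expr0n.
by rewrite -exprM mulnC exprM -signr_odd /= odd_k expr0 expr1n.
Qed.

Lemma test_vector_sum_pow (B A : {set 'I_n}) : s \notin A ->
  \sum_(i in A) test_vector B ord0 i ^+ k.+1 = #|A :&: neighbours|%:R.
Proof.
move=> sA; rewrite (eq_bigr (fun i => (i \in neighbours)%:R)); last first.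
  by move=> i iA; apply: test_vector_pow; apply: contraNneq sA => <-.
rewrite -natr_sum -big_mkcondr /= sum1_card; congr _%:R.
by apply: eq_card => i; rewrite !inE.
Qed.

Lemma centre_pow (B : {set 'I_n}) : test_vector B ord0 s ^+ k.+1 = a ^+ k.+1.
Proof. by rewrite mxE eqxx exprNn -signr_odd /= odd_k expr0 mul1r. Qed.

Lemma power_sum_test_vector (B : {set 'I_n}) :
  power_sum k.+1 (test_vector B) = a ^+ k.+1 + #|neighbours|%:R.
Proof.
rewrite /power_sum (bigD1 s) //= centre_pow; congr (_ + _).
rewrite (eq_bigl (mem [set~ s])) => [|i]; last by rewrite !inE.
rewrite test_vector_sum_pow ?inE ?eqxx //; congr _%:R.
apply: eq_card => i; rewrite !inE.
by case: eqVneq => //= ->; rewrite (negbTE centre_notin_neighbours).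
Qed.

Lemma test_vector_star_edge (B e : {set 'I_n}) :
    balanced B -> e \in E -> s \in e ->
  \sum_(i in e) test_vector B ord0 i ^+ k.+1
    - k.+1%:R * \prod_(i in e) test_vector B ord0 i
  = a ^+ k.+1 + k%:R + k.+1%:R * a.
Proof.
move=> balB eE se; have eL : e :\ s \in link by apply/linkP; exists e.
rewrite (big_setD1 s) //= centre_pow test_vector_sum_pow ?inE ?eqxx //.
have -> : (e :\ s) :&: neighbours = e :\ s.
  apply/setIidPl/subsetP => v; rewrite !inE => /andP[vs ve].
  exact: edge_neighbours eE se ve vs.
rewrite card_link_set // (big_setD1 s) //= [test_vector B ord0 s]mxE eqxx.
rewrite (eq_bigr (fun i => (-1) ^+ (i \in B))) => [|i]; last first.
  rewrite !inE mxE => /andP[i_s ie].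
  by rewrite (negbTE i_s) (edge_neighbours _ _ eE se ie i_s).
rewrite prod_sign_indicator -signr_odd (negbTE (balB _ eL)) expr0.
by rewrite mulr1 mulrN opprK.
Qed.

Lemma test_vector_other_edge (B f : {set 'I_n}) : s \notin f ->
  \sum_(i in f) test_vector B ord0 i ^+ k.+1
    - k.+1%:R * \prod_(i in f) test_vector B ord0 i
  = excess B f.
Proof.
move=> sf; rewrite test_vector_sum_pow // /excess; congr (_ - _ * _).
case: ifP => [/subsetP fN|/negbT/subsetPn[v vf vN]].
  rewrite -prod_sign_indicator; apply: eq_bigr => i fi; rewrite mxE fN //.
  by case: eqVneq fi sf => // -> ->.
rewrite (bigD1 v) //= mxE (negbTE vN); case: eqVneq => [vs|_]; last by rewrite mul0r.
by rewrite -vs vf in sf.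
Qed.

Lemma excess_ge0 (B f : {set 'I_n}) : f \in E -> 0 <= excess B f.
Proof.
move=> fE; rewrite /excess; case: ifP => [/setIidPl->|_]; last first.
  by rewrite mulr0 subr0 ler0n.
rewrite (cardE _ fE) subr_ge0 ler_piMr //.
by rewrite -signr_odd; case: odd; rewrite ?expr1 ?expr0; lra.
Qed.

Lemma laplacian_form_test_vector (B : {set 'I_n}) : balanced B ->
  laplacian_form k.+1 E (test_vector B)
  = (degree E s)%:R * (a ^+ k.+1 + k%:R + k.+1%:R * a)
    + \sum_(f in E | s \notin f) excess B f.
Proof.
move=> balB; rewrite /laplacian_form (bigID (fun e : {set 'I_n} => s \in e)) /=.
rewrite -sum_degree_const; congr (_ + _).
  by apply: eq_bigr => e /andP[eE se]; exact: test_vector_star_edge.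
by apply: eq_bigr => f /andP[fE sf]; exact: test_vector_other_edge.
Qed.

Hypothesis a_gt0 : 0 < a.
Hypothesis equation_a : a ^+ k * (a + 1 - (degree E s)%:R) = (degree E s)%:R.
Hypothesis form_le : forall y : 'rV[R]_n,
  laplacian_form k.+1 E y <= (a + 1) * power_sum k.+1 y.

(** Write D for the degree of [s] and N for its set of neighbours. The equation for [a] reduces
    [form_le] at the test vector to (a + 1)(D k - |N|) + S <= 0, where S is the total excess. Both
    summands are nonnegative, so both vanish. *)
Lemma balanced_tight (B : {set 'I_n}) : balanced B ->
  trivIset link /\ forall f, f \in E -> s \notin f -> excess B f = 0.
Proof.
move=> balB; have := form_le (test_vector B).
rewrite laplacian_form_test_vector // power_sum_test_vector.
have eq_a := equation_a.
set S := \sum_(f in E | _) _; set D := degree E s in eq_a *.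
have S0 : 0 <= S by apply: sumr_ge0 => f /andP[fE _]; exact: excess_ge0.
have -> : D%:R * (a ^+ k.+1 + k%:R + k.+1%:R * a)
    = (a + 1) * (a ^+ k.+1 + (D * k)%:R).
  apply/eqP; rewrite -subr_eq0 natrM -natr1 exprS.
  (* The difference of the two sides is a multiple of the defect in [equation_a]. *)
  rewrite [X in X == 0](_ : _ = a * (D%:R - a ^+ k * (a + 1 - D%:R))); last ring.
  by rewrite eq_a subrr mulr0.
have N_le : #|neighbours|%:R <= (D * k)%:R :> R by rewrite ler_nat card_neighbours.
move=> le_form.
have gap0 : 0 <= (a + 1) * ((D * k)%:R - #|neighbours|%:R) :> R.
  by rewrite mulr_ge0 ?subr_ge0 // addr_ge0 // ltW.
have : (a + 1) * ((D * k)%:R - #|neighbours|%:R) + S == 0.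
  by rewrite eq_le addr_ge0 // andbT; lra.
rewrite paddr_eq0 // => /andP[+ /eqP S_0].
rewrite mulf_eq0 => /orP[/eqP a1|]; first by have := a_gt0; lra.
rewrite subr_eq0 eqr_nat eq_sym card_neighbours => tI; split=> // f fE sf.
have /eqP := S_0; rewrite psumr_eq0 => [|e /andP[eE _]]; last exact: excess_ge0.
by move/allP/(_ f (mem_index_enum _)); rewrite fE sf => /eqP.
Qed.

Lemma balanced_set0 : balanced set0.
Proof. by move=> A _; rewrite setI0 cards0. Qed.

Lemma trivIset_link : trivIset link.
Proof. exact: (balanced_tight _ balanced_set0).1. Qed.

Lemma link_disjoint (A B : {set 'I_n}) (v : 'I_n) :
  A \in link -> B \in link -> v \in A -> v \in B -> A = B.
Proof.
move=> AL BL vA vB; apply: contraTeq vB => AB.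
by have /trivIsetP/(_ _ _ AL BL AB)/disjointFr/(_ vA)-> := trivIset_link.
Qed.

(** Flipping the signs at [j] and [l] will preserve the product over [A] and reverse the one over
    [f]. If every link set meeting [f] lay inside [f], then [f] would contain two disjoint ones,
    since a single one has only [k] elements. *)
Lemma exists_split_link (f : {set 'I_n}) : f \in E -> f \subset neighbours ->
  exists A j l, [/\ A \in link, j \in A :&: f, l \in A & l \notin f].
Proof.
move=> fE /subsetP fN.
have /card_gt0P[j jf] : (0 < #|f|)%N by rewrite (cardE _ fE).
have /bigcupP[A AL jA] := fN _ jf.
have [Af|/subsetPn[l lA lf]] := boolP (A \subset f); last first.
  by exists A, j, l; rewrite inE jA jf.
have /subsetPn[j' jf' jA'] : ~~ (f \subset A).
  by apply/negP => /subset_leq_card; rewrite (cardE _ fE) (card_link_set _ AL) ltnn.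
have /bigcupP[A' AL' jA''] := fN _ jf'.
have [Af'|/subsetPn[l lA lf]] := boolP (A' \subset f); last first.
  by exists A', j', l; rewrite inE jA'' jf'.
have AA' : [disjoint A & A'].
  apply: (trivIsetP trivIset_link) => //.
  by apply: contraNneq jA' => ->.
have := subset_leq_card (_ : A :|: A' \subset f); rewrite subUset Af Af' => /(_ isT).
rewrite cardsU disjoint_setI0 // cards0 subn0.
rewrite (card_link_set _ AL) (card_link_set _ AL') (cardE _ fE).
(* Two disjoint link sets inside [f] would give 2k <= k + 1, against k > 1. *)
by rewrite -addn1 leq_add2l leqNgt k_gt1.
Qed.

(** If [f] is not inside [neighbours], the unflipped vector suffices, as the excess is then the
    number of neighbours in [f]. If it is inside, that excess is 0 anyway and a sign flip is
    needed. *)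
Lemma off_centre_disjoint (f : {set 'I_n}) (v : 'I_n) :
  f \in E -> s \notin f -> v \in f -> v \notin neighbours.
Proof.
move=> fE sf vf; have [fN|fN] := boolP (f \subset neighbours); last first.
  have := (balanced_tight _ balanced_set0).2 f fE sf.
  rewrite /excess (negbTE fN) mulr0 subr0 => /eqP.
  rewrite pnatr_eq0 cards_eq0 => /eqP/setP/(_ v).
  by rewrite !inE vf /= => ->.
have [A [j [l [AL /setIP[jA jf] lA lf]]]] := exists_split_link _ fE fN.
(* Both flipped vertices lie in [A], and the other link sets are disjoint from [A]. *)
have balB : balanced [set j; l].
  move=> A' AL'; have [<-|AA'] := eqVneq A A'.
    rewrite (setIidPr _) ?cards2; last by rewrite subUset !sub1set jA lA.
    by have -> : j != l by apply: contraNneq lf => <-.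
  suff -> : A' :&: [set j; l] = set0 by rewrite cards0.
  apply/setP => w; rewrite !inE; apply/andP => -[wA' /orP[]/eqP wE];
    by move: AA'; rewrite (link_disjoint A A' w) ?eqxx ?wE // -wE.
have [_ /(_ f fE sf)] := balanced_tight _ balB.
rewrite /excess fN (setIidPl fN).
have -> : f :&: [set j; l] = [set j].
  apply/setP => w; rewrite !inE; have [->|] := eqVneq w j; first by rewrite jf.
  by have [->|] := eqVneq w l; rewrite ?(negbTE lf) ?andbF.
(* Exactly one sign is flipped within [f], so its excess is 2(k + 1), which is not 0. *)
rewrite cards1 expr1 (cardE _ fE) mulrN1 opprK => /eqP.
by rewrite -natrD pnatr_eq0.
Qed.

(** A walk cannot leave the edges through [s]: the first edge missing [s] would share a neighbour of
    [s] with its predecessor. *)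
Lemma path_centre (e : {set 'I_n}) (p : seq {set 'I_n}) :
    all [in E] (e :: p) -> path (fun e f : {set 'I_n} => e :&: f != set0) e p ->
  s \in e -> s \in last e p.
Proof.
elim: p e => // f p IHp e /= /andP[eE /andP[fE pE]].
move=> /andP[/set0Pn[w /setIP[we wf]] fp] se.
apply: (IHp f) => //=; first by rewrite fE.
apply: contraTT wf => sf; apply/negP => wf.
have /negP := off_centre_disjoint _ _ fE sf wf; apply.
by apply: edge_neighbours eE se we _; apply: contraNneq sf => <-.
Qed.

(** A walk from [s] to a vertex [v] of an edge missing [s] ends in an edge through [s], which makes
    [v] a neighbour and contradicts [off_centre_disjoint]. *)
Lemma tight_star_centre : star_centre E s.
Proof.
have sE f : f \in E -> s \in f.
  move=> fE; apply/negPn/negP => sf.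
  have /card_gt0P[v vf] : (0 < #|f|)%N by rewrite (cardE _ fE).
  have vs : v != s by apply: contraNneq sf => <-.
  have [|e [p [epE se vp ep]]] := connE s v; first by rewrite eq_sym.
  have sp := path_centre _ _ epE ep se.
  have lE : last e p \in E by apply: (allP epE); exact: mem_last.
  have /negP := off_centre_disjoint _ _ fE sf vf; apply.
  exact: edge_neighbours lE sp vp vs.
split=> // e f v eE fE ef ve vf; apply: contra_neq_eq ef => vs.
apply: setD1_inj_in; rewrite ?inE ?eE ?fE ?sE //.
by apply: (link_disjoint _ _ v);
  rewrite ?inE ?vs //; apply/linkP; [exists e|exists f]; rewrite sE.
Qed.

End Converse.

(** * Both directions combined, and uniqueness of the root *)

Lemma largest_iff_hyperstar (R : realType) (n k : nat) (E : {set {set 'I_n}})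
    (r : R) : (1 < k)%N -> odd k ->
    uniform_hypergraph E k.+1 -> connected_hypergraph E ->
    (0 < max_degree E)%N -> (max_degree E)%:R < r ->
    (1 - r) ^+ k * (r - (max_degree E)%:R) + (max_degree E)%:R = 0 ->
  largest_H_eigenvalue (laplacian_tensor R k.+1 E) r <-> hyperstar E k.+1.
Proof.
move=> k1 odd_k uniE connE d_gt0 dr rE; have [kn _ cardE] := uniE.
split=> [rmax|/hyperstar_centre[s starE]]; last first.
  split=> [|mu]; first exact: star_eigenvalue cardE connE starE (ltnW k1) d_gt0 _ rE.
  exact: star_eigenvalue_le cardE connE starE (ltnW k1) d_gt0 _ _ odd_k dr rE.
have [|s dE] := @bigop.eq_bigmax 'I_n (degree E).
  by rewrite card_ord (leq_trans _ kn).
rewrite -/(max_degree E) in dE.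
have d1 : 1 <= (max_degree E)%:R :> R by rewrite ler1n.
apply: (centre_hyperstar _ _ s) => //.
(* The choice a = r - 1 turns [equation_a] into the equation for [r] with positive base. *)
apply: (@tight_star_centre R k n E s cardE connE odd_k k1 (r - 1)).
- lra.
- by rewrite -dE subrK; apply/equation_pos.
- by move=> y; rewrite subrK; exact: laplacian_form_le_largest.
Qed.

(** Strict monotonicity above [d] gives uniqueness. The interval stays general to serve both the
    open and the half-open case. *)
Lemma equation_unique_root (R : realType) (k d : nat) (I : interval R) (r : R) :
    odd k -> (0 < d)%N -> {in I, forall x, d%:R < x} -> r \in I ->
    (1 - r) ^+ k * (r - d%:R) + d%:R = 0 ->
  unique_root_in k.+1 d I r.
Proof.
move=> odd_k d_gt0 I_gt rI rE; split=> // y [yI yE].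
have /equation_pos rP := rE; have /equation_pos yP := yE.
by have [/(equation_lt _ k _ _ _ d_gt0 (ltW (I_gt _ rI)))|
  /(equation_lt _ k _ _ _ d_gt0 (ltW (I_gt _ yI)))|] := ltgtP r y;
  rewrite ?(rP odd_k) ?(yP odd_k) ?ltxx.
Qed.

(* For d = 1 the equation has no root in (d, d + 1): its root is the endpoint
   d + 1 = 2, which is the largest H-eigenvalue of a single edge.  Hence the
   open interval is used for d > 1, and (d, d + 1] covers every d > 0. *)
Theorem theorem3p4 (R : realType) (n k d : nat) (E : {set {set 'I_n}})
    (k_ge4 : (4 <= k)%N) (k_even : ~~ odd k)
    (uniformE : uniform_hypergraph E k)
    (connectedE : connected_hypergraph E)
    (max_degreeE : max_degree E = d) (d_gt0 : (0 < d)%N) :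
  ((1 < d)%N -> root_criterion k d E `](d%:R : R), (d%:R + 1 : R)[)
  /\ root_criterion k d E `](d%:R : R), (d%:R + 1 : R)].
Proof.
case: k => // k in k_ge4 k_even uniformE *.
have odd_k : odd k by rewrite -[odd k]negbK.
have k_gt1 : (1 < k)%N by rewrite -ltnS (leq_trans _ k_ge4).
have [r [dr r_le r_lt rE]] := equation_root R k d odd_k k_gt1 d_gt0.
have crit : largest_H_eigenvalue (laplacian_tensor R k.+1 E) r
    <-> hyperstar E k.+1.
  by apply: largest_iff_hyperstar; rewrite ?max_degreeE.
split=> [d_gt1|]; exists r; split=> //; apply: equation_unique_root => //.
- by move=> x; rewrite in_itv => /andP[].
- by rewrite in_itv /= dr r_lt.
- by move=> x; rewrite in_itv => /andP[].
- by rewrite in_itv /= dr r_le.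
Qed.
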